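(* Let $k\ge1$, let $x\in\tilde S_{k+1}$ be an affine permutation with maximal decomposition $x=d_{A_n}\cdots d_{A_1}$ into cyclically decreasing elements, and let $T=\sigma(x)$ be its $k$-code filling. Then $r\in D_R(x)$ if and only if $r$ appears in the first row of $T$ and the column of $T$ containing this box contains a right descent of one of the $d_{A_i}$ (i.e. for some row $i$, the residue $m$ of the box of $T$ in that column and row $i$ is in $D_R(d_{A_i})$).
   Context: Fix $k\ge1$, $I=\mathbb Z/(k+1)\mathbb Z$. $\tilde S_{k+1}$ is the affine symmetric group with simple generators $s_i$, $i\in I$. The affine nil-Coxeter monoid is generated by $a_i$ ($i\in I$) and an absorbing zero, with relations $a_i^2=0$, $a_ia_j=a_ja_i$ for $j\notin\{i-1,i,i+1\}$, and (for $k\ge2$) $a_ia_{i+1}a_i=a_{i+1}a_ia_{i+1}$; its nonzero elements are identified with affine permutations via reduced words. For $A\subsetneq I$, $d_A$ is the product of the $a_i$, $i\in A$, each once, with $a_j$ left of $a_{j-1}$ whenever $j,j-1\in A$. The right descent set is $D_R(w)=\{p\in I: wa_p=0\}$, equivalently the set of $p$ such that $w$ has a reduced word ending in $p$. Every affine permutation $x$ has a unique maximal decomposition $x=d_{A_n}\cdots d_{A_1}$ ($A_i\subsetneq I$ nonempty), i.e. with $(|A_1|,\dots,|A_n|)$ lexicographically maximal; it satisfies $A_{j+1}\subset A_j-1:=\{s-1:s\in A_j\}$. The filling $\sigma(x)$ is a diagram with rows $1,2,\dots,n$ (row 1 at the bottom) and columns indexed cyclically by $I$: for each $j$ and each $r\in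 A_j$ there is a box with residue $r$ in row $j$ and column $r+(j-1)$. (So the box in column $i$ and row $j$ has residue $i-(j-1)$, and each column consists of boxes in consecutive rows starting from row 1.) *)

(* Defs.v *)
From HB Require Import structures.
From mathcomp Require Import all_boot all_order all_algebra.
Set Implicit Arguments.
Unset Strict Implicit.
Unset Printing Implicit Defensive.
Import Order.TTheory GRing.Theory Num.Theory.
Local Open Scope ring_scope.

(* Throughout, k is at least 1 and the index set Z/(k+1)Z is 'Z_k.+1.  (For
   k = 0 the library type 'Z_k.+1 would be Z/2Z: nothing here is meant to be
   used for k = 0.) *)

(** * The affine symmetric group *)

(* Affine permutations as the bijections w of the integers with
   w (j + (k+1)) = w j + (k+1) and w 1 + ... + w (k+1) = 1 + ... + (k+1);
   the group law is composition. *)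
Record affine_perm (k : nat) := AffinePerm {
  aperm_fun :> int -> int;
  aperm_bij : bijective aperm_fun;
  aperm_shift : forall j : int, aperm_fun (j + k.+1%:Z) = aperm_fun j + k.+1%:Z;
  aperm_sum :
    \sum_(1 <= j < k.+2) aperm_fun j%:Z = \sum_(1 <= j < k.+2) j%:Z }.

(* The simple generator s_i exchanges j and j + 1 for every j congruent to i;
   j%:~R is the class of the integer j modulo k + 1. *)
Definition simple_refl (k : nat) (i : 'Z_k.+1) (j : int) : int :=
  if j%:~R == i then j + 1 else if j%:~R == i + 1 then j - 1 else j.

Definition word_prod (k : nat) (u : seq 'Z_k.+1) : int -> int :=
  foldr (fun i f => simple_refl i \o f) id u.

Definition reduced_word (k : nat) (x : affine_perm k) (u : seq 'Z_k.+1) : Prop :=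
  word_prod u =1 x /\
  forall v : seq 'Z_k.+1, word_prod v =1 x -> (size u <= size v)%N.

(** * The affine nil-Coxeter monoid *)

(* The monoid is presented as the free monoid with zero on 'Z_k.+1 (None is the
   absorbing zero, Some u the product of the generators listed in u) modulo the
   congruence nilcox_eq. *)
Definition nilword (k : nat) : Type := option (seq 'Z_k.+1).

Definition nil_zero (k : nat) : nilword k := None.

Definition nil_one (k : nat) : nilword k := Some [::].

Definition nil_gen (k : nat) (i : 'Z_k.+1) : nilword k := Some [:: i].

Definition nil_mul (k : nat) (m n : nilword k) : nilword k :=
  if m is Some u then if n is Some v then Some (u ++ v) else None else None.

Inductive nilcox_eq (k : nat) : nilword k -> nilword k -> Prop :=
| nilcox_refl m : nilcox_eq m m
| nilcox_sym m n : nilcox_eq m n -> nilcox_eq n m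
| nilcox_trans m n p : nilcox_eq m n -> nilcox_eq n p -> nilcox_eq m p
| nilcox_mul m m' n n' :
    nilcox_eq m m' -> nilcox_eq n n' -> nilcox_eq (nil_mul m n) (nil_mul m' n')
| nilcox_square i :
    nilcox_eq (nil_mul (nil_gen i) (nil_gen i)) (nil_zero k)
| nilcox_comm i j : j \notin [:: i - 1; i; i + 1] ->
    nilcox_eq (nil_mul (nil_gen i) (nil_gen j)) (nil_mul (nil_gen j) (nil_gen i))
| nilcox_braid i : (2 <= k)%N ->
    nilcox_eq
      (nil_mul (nil_mul (nil_gen i) (nil_gen (i + 1))) (nil_gen i))
      (nil_mul (nil_mul (nil_gen (i + 1)) (nil_gen i)) (nil_gen (i + 1))).

(* Identification of affine permutations with nonzero elements of the monoid:
   m is the element given by a reduced word of x. *)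
Definition nil_of_perm (k : nat) (x : affine_perm k) (m : nilword k) : Prop :=
  exists2 u : seq 'Z_k.+1, reduced_word x u & nilcox_eq m (Some u).

Definition right_descent (k : nat) (m : nilword k) (p : 'Z_k.+1) : Prop :=
  nilcox_eq (nil_mul m (nil_gen p)) (nil_zero k).

Definition perm_right_descent (k : nat) (x : affine_perm k) (p : 'Z_k.+1) : Prop :=
  exists2 m : nilword k, nil_of_perm x m & right_descent m p.

(** * Cyclically decreasing elements and maximal decompositions *)

Definition cyc_decreasing (k : nat) (A : {set 'Z_k.+1}) (u : seq 'Z_k.+1) : bool :=
  perm_eq u (enum A) &&
  [forall j in A, (j - 1 \in A) ==> (index j u < index (j - 1)%R u)%N].

(* For a proper subset A a word as required exists, and any two of them are equal
   in the monoid.  For A = setT there is none, and d_elt A is 0. *)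
Definition d_elt (k : nat) (A : {set 'Z_k.+1}) : nilword k :=
  omap val [pick u : #|A|.-tuple 'Z_k.+1 | cyc_decreasing A u].

(* A decomposition d_{A_n} ... d_{A_1} is recorded as the list
   [:: A_1; ...; A_n], hence the reversal in the product. *)
Definition decomposition (k : nat) (x : affine_perm k) (A : seq {set 'Z_k.+1}) :
    Prop :=
  {in A, forall B, B != set0 /\ B \proper [set: 'Z_k.+1]} /\
  nil_of_perm x (\big[@nil_mul k/nil_one k]_(B <- rev A) d_elt B).

(* Lists of cardinals, in the order |A_1|, ..., |A_n|, compared lexicographically
   (a proper prefix being smaller). *)
Definition card_seq (k : nat) (A : seq {set 'Z_k.+1}) : seqlexi nat :=
  [seq #|B| | B : {set 'Z_k.+1} <- A].

Definition maximal_decomposition (k : nat) (x : affine_perm k)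
    (A : seq {set 'Z_k.+1}) : Prop :=
  decomposition x A /\
  forall A' : seq {set 'Z_k.+1},
    decomposition x A' -> (card_seq A' <= card_seq A)%O.

(** * The k-code filling *)

Record box (k : nat) := Box {
  box_row : nat;
  box_col : 'Z_k.+1;
  box_res : 'Z_k.+1 }.

(* A_j, with j counted from 1 as the rows of the filling are. *)
Definition row_set (k : nat) (A : seq {set 'Z_k.+1}) (j : nat) : {set 'Z_k.+1} :=
  nth set0 A j.-1.

Definition filling (k : nat) (A : seq {set 'Z_k.+1}) : pred (box k) :=
  fun b => [&& (1 <= box_row b <= size A)%N,
               box_res b \in row_set A (box_row b) &
               box_col b == box_res b + (box_row b).-1%:R].

(* Main.v *)
(* Idea: attach to an affine permutation x its code, the periodic sequence
   h(c) = #{j <= c : x(j) > x(c+1)}.  Right multiplication by s_r at an ascent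
   turns (h(r-1), h(r)) into (h(r), h(r-1)+1), so r is a right descent of x iff
   h(r-1) < h(r).  These moves, set to zero at descents, satisfy the nil-Coxeter
   relations, so the monoid acts on codes.  If x = y d_B is a length-additive
   factorization then B lies in the support of h, and for B = supp h the code of
   y is c |-> h(c+1) - 1 (truncated).  Hence in the lexicographically maximal
   decomposition column c of the filling has height h(c), and it contains a
   right descent of some d_{A_i} iff it is higher than column c-1. *)
Require Import Defs.
From HB Require Import structures.
From mathcomp Require Import all_boot all_order all_fingroup all_algebra.
From mathcomp Require Import zify ring.
Import Order.TTheory GRing.Theory Num.Theory.
Set Implicit Arguments.
Unset Strict Implicit.
Unset Printing Implicit Defensive.
Local Open Scope ring_scope.

(** * The action of the nil-Coxeter monoid on codes *)

Section CodeAction.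
Variable k : nat.
Local Notation I := 'Z_k.+2.
Local Notation code := {ffun I -> nat}.
Implicit Types (h g : code) (r c : I) (u v : seq I) (m : nilword k.+1).

Lemma subr1_neq r : (r - 1 == r) = false.
Proof. by rewrite -[X in _ == X]subr0 (inj_eq (addrI r)) eqr_opp oner_eq0. Qed.

(* The action of a_r on codes; None is the zero of the monoid. *)
Definition bump_at h r : option code :=
  if (h r <= h (r - 1)%R)%N then
    Some [ffun c => if c == r then (h (r - 1)%R).+1
                    else if c == r - 1 then h r else h c]
  else None.

Definition code_act (o : option code) u : option code :=
  foldl (fun o r => obind (bump_at^~ r) o) o u.

Definition nil_act (o : option code) m : option code :=
  if m is Some u then code_act o u else None.

Lemma act_none u : code_act None u = None.
Proof. by elim: u. Qed.

Lemma act_cat o u v : code_act o (u ++ v) = code_act (code_act o u) v.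
Proof. exact: foldl_cat. Qed.

Lemma act_rcons o u r : code_act o (rcons u r) = obind (bump_at^~ r) (code_act o u).
Proof. exact: foldl_rcons. Qed.

Lemma nil_act_none m : nil_act None m = None.
Proof. by case: m => //= u; exact: act_none. Qed.

Lemma nil_act_mul o m m' : nil_act o (nil_mul m m') = nil_act (nil_act o m) m'.
Proof.
case: m m' => [u|] [v|] //=; first exact: act_cat.
by rewrite act_none.
Qed.

Lemma bump_atP h r g : bump_at h r = Some g ->
  [/\ (h r <= h (r - 1)%R)%N, g r = (h (r - 1)%R).+1, g (r - 1) = h r &
      forall c, c != r -> c != r - 1 -> g c = h c].
Proof.
rewrite /bump_at; case: ifP => // le_h [<-]; split=> //.
- by rewrite ffunE eqxx.
- by rewrite ffunE subr1_neq eqxx.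
- by move=> c /negPf cr /negPf cr1; rewrite ffunE cr cr1.
Qed.

Lemma bump_atE h r g : (h r <= h (r - 1)%R)%N -> g r = (h (r - 1)%R).+1 ->
  g (r - 1) = h r -> (forall c, c != r -> c != r - 1 -> g c = h c) ->
  bump_at h r = Some g.
Proof.
move=> le_h gr gr1 gc; rewrite /bump_at le_h; congr Some; apply/ffunP=> c.
rewrite ffunE; have [->//|cr] := eqVneq c r.
by have [->//|cr1] := eqVneq c (r - 1); rewrite gc.
Qed.

(** A move swaps two neighbouring entries and raises one by 1, so it can be undone. This later
    identifies the code of a left cofactor. *)
Lemma bump_at_inj r h h' g : bump_at h r = Some g -> bump_at h' r = Some g -> h = h'.
Proof.
move=> /bump_atP[_ a1 b1 c1] /bump_atP[_ a2 b2 c2]; apply/ffunP=> c.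
have [->|cr] := eqVneq c r; first by rewrite -b1.
have [->|cr1] := eqVneq c (r - 1); last by rewrite -c1 // c2.
by apply: succn_inj; rewrite -a1.
Qed.

Lemma bump_at_lt h r g : bump_at h r = Some g -> (g (r - 1)%R < g r)%N.
Proof. by move=> /bump_atP[le_h -> -> _]. Qed.

(** Makes the sum of the entries play the role of Coxeter length. *)
Lemma sum_bump_at h r g : bump_at h r = Some g ->
  (\sum_c g c = (\sum_c h c).+1)%N.
Proof.
move=> /bump_atP[_ gr gr1 gc].
rewrite (bigD1 r) // (bigD1 (r - 1)) /=; last by rewrite subr1_neq.
rewrite [in RHS](bigD1 r) // [in RHS](bigD1 (r - 1)) /=; last by rewrite subr1_neq.
rewrite gr gr1 (eq_bigr h) => [|c /andP[]]; last by move=> *; exact: gc.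
by rewrite !addSn !addnA (addnC (h r)).
Qed.

Lemma act_inj u h h' g : code_act (Some h) u = Some g -> code_act (Some h') u = Some g ->
  h = h'.
Proof.
elim/last_ind: u g => [|u r IH] g; first by move=> /= [->] [->].
rewrite !act_rcons; case E: (code_act (Some h) u) => [f|] //=.
case E': (code_act (Some h') u) => [f'|] //= B B'.
by apply: (IH f) => //; rewrite E' (bump_at_inj B B').
Qed.

Lemma sum_act u g : code_act (Some [ffun=> 0%N]) u = Some g ->
  (\sum_c g c = size u)%N.
Proof.
elim/last_ind: u g => [|u r IH] g.
  by move=> /= [<-]; rewrite big1 // => c; rewrite ffunE.
rewrite act_rcons size_rcons; case E: (code_act _ u) => [f|] //= B.
by rewrite (sum_bump_at B) (IH f).
Qed.

(** Square: a move at [r] leaves a strict rise there, which blocks a second one. Commutation: the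
    moves touch disjoint pairs of entries. Braid: either side sends the entries [(x, y, z)] at
    [r - 1], [r], [r + 1] to [(z, y + 1, x + 2)] and is defined exactly when [z <= y <= x]. *)
Lemma nilcox_nil_act m m' : nilcox_eq m m' -> forall o, nil_act o m = nil_act o m'.
Proof.
elim=> {m m'} [m|m m' _ IH|m m' p _ IH1 _ IH2|m m' p p' _ IH1 _ IH2|r|r s rs|r hk] o //.
- by rewrite IH1 IH2.
- by rewrite !nil_act_mul IH1 IH2.
- case: o => [h|] //=; case E: (bump_at h r) => [g|] //=.
  by rewrite /bump_at leqNgt (bump_at_lt E).
- move: rs; rewrite !inE !negb_or => /and3P[/negPf s1 /negPf s2 s3]; case: o => [h|] //=.
  have s4 : (s - 1 == r) = false by apply: contraNF s3 => /eqP<-; rewrite subrK.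
  have s5 : (s - 1 == r - 1) = false by rewrite (inj_eq (addIr _)).
  have s6 := s4; have s7 := s1; have s8 := s2; have s9 := s5.
  rewrite eq_sym in s6; rewrite eq_sym in s7; rewrite eq_sym in s8; rewrite eq_sym in s9.
  rewrite /bump_at; case hr: (h r <= h (r - 1)%R)%N; case hs: (h s <= h (s - 1)%R)%N => //=;
    rewrite ?hr ?hs //= ?ffunE ?s1 ?s2 ?s4 ?s5 ?s6 ?s7 ?s8 ?s9 ?hr ?hs //=.
  congr Some; apply/ffunP=> c; rewrite !ffunE ?s1 ?s2 ?s4 ?s5 ?s6 ?s7 ?s8 ?s9.
  have [->|cr] := eqVneq c r; first by rewrite s8 s6.
  by have [->|//] := eqVneq c (r - 1); rewrite s7 s9 ?subr1_neq ?eqxx.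
(* With at least three residues, [r - 1], [r] and [r + 1] are distinct. *)
- have k3 : (2%:R == 0 :> I) = false.
    by apply/negbTE/eqP => /(congr1 val) /=; rewrite /= !modn_small // !ltnS.
  have e0 : r + 1 - 1 = r by rewrite addrK.
  have n1 : (r + 1 == r) = false by rewrite -{2}e0 eq_sym subr1_neq.
  have n2 : (r + 1 == r - 1) = false.
    by rewrite -(inj_eq (addIr 1)) subrK -addrA -[X in _ == X]addr0 (inj_eq (addrI r)).
  have n3 := subr1_neq r; have n4 := n1; have n5 := n2; have n6 := n3.
  rewrite eq_sym in n4; rewrite eq_sym in n5; rewrite eq_sym in n6.
  case: o => [h|] //=; rewrite /bump_at.
  case hr: (h r <= h (r - 1)%R)%N; case hs: (h (r + 1)%R <= h r)%N;
    rewrite /= ?e0 ?hs //= ?ffunE ?e0 ?eqxx ?n1 ?n2 ?n3 ?n4 ?n5 ?n6 //=.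
  all: rewrite ?e0 ?eqxx ?n1 ?n2 ?n3 ?n4 ?n5 ?n6 //=.
  - have hrs := leq_trans hs hr; rewrite hrs (leq_trans hrs (leqnSn _)) /=.
    rewrite !ffunE ?e0 ?eqxx ?n1 ?n2 ?n3 ?n4 ?n5 ?n6 /= ltnS hr hs.
    congr Some; apply/ffunP=> c; rewrite !ffunE ?e0 ?eqxx ?n1 ?n2 ?n3 ?n4 ?n5 ?n6.
    have [->|_] := eqVneq c (r + 1); first by rewrite n1 n2.
    by case: (eqVneq c r) => // _; case: (eqVneq c (r - 1)).
  - case: ifP => //= _.
    by rewrite !ffunE ?e0 ?eqxx ?n1 ?n2 ?n3 ?n4 ?n5 ?n6 /= hs.
  - case: ifP => //= _.
    by rewrite !ffunE ?e0 ?eqxx ?n1 ?n2 ?n3 ?n4 ?n5 ?n6 /= ltnS hr.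
Qed.

End CodeAction.

(** * Cyclically decreasing words and the greedy decomposition of a code *)

Section CyclicallyDecreasing.
Variable k : nat.
Local Notation I := 'Z_k.+2.
Local Notation code := {ffun I -> nat}.
Implicit Types (h g : code) (r c j : I) (u v : seq I) (A B : {set I}).

Definition supp h : {set I} := [set c | (0 < h c)%N].
Definition zero_code : code := [ffun=> 0%N].

Lemma cyc_decreasingP A u : reflect
  [/\ uniq u, u =i A & forall j, j \in A -> j - 1 \in A ->
        (index j u < index (j - 1)%R u)%N]
  (@cyc_decreasing k.+1 A u).
Proof.
apply: (iffP andP) => [[up /forallP uA]|[uu uA ui]].
  split; first by rewrite (perm_uniq up) enum_uniq.
    by move=> c; rewrite (perm_mem up) mem_enum.
  by move=> j jA j1A; have := uA j; rewrite jA j1A.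
split.
  by apply: uniq_perm => //; [exact: enum_uniq | move=> c; rewrite mem_enum uA].
by apply/forallP=> j; apply/implyP=> jA; apply/implyP=> j1A; exact: ui.
Qed.

Lemma val_addr1 r : r + 1 != 0 -> (r + 1 : I) = (r : nat).+1 :> nat.
Proof.
case: r => m lt_m r0; rewrite /= (modn_small (isT : 1 < k.+2)%N) addn1 modn_small //.
rewrite ltn_neqAle lt_m andbT; apply: contra r0 => /eqP m1.
by apply/eqP/val_inj; rewrite /= (modn_small (isT : 1 < k.+2)%N) addn1 m1 modnn.
Qed.

(** Cut the circle at a residue [a] outside [A] and sort by [a - j]. Going from [j] to [j - 1]
    raises this key by one unless [j - 1 = a], which is not in [A]. *)
Lemma ex_cyc_decreasing A : A \proper [set: I] -> exists u, @cyc_decreasing k.+1 A u.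
Proof.
case/properP=> _ [a _ aA].
pose key (j : I) := nat_of_ord (a - j).
pose le_key : rel I := fun i j => (key i <= key j)%N.
have tot : total le_key by move=> i j; exact: leq_total.
have tr : transitive le_key by move=> i j l; exact: leq_trans.
exists (sort le_key (enum A)); apply/cyc_decreasingP; split.
- by rewrite sort_uniq enum_uniq.
- by move=> c; rewrite mem_sort mem_enum.
move=> j jA j1A; rewrite ltnNge; apply/negP => le_ij.
have key_lt : (key j < key (j - 1)%R)%N.
  have aj : a - (j - 1) = a - j + 1 by rewrite opprB addrA addrAC.
  rewrite /key aj val_addr1 // -aj subr_eq0.
  by apply: contraNneq aA => ->.
have in_sort c : c \in A -> c \in sort le_key (enum A) by rewrite mem_sort mem_enum.
move: le_ij; rewrite leq_eqVlt => /orP[/eqP /index_inj|/(sorted_ltn_index tr)].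
  by move=> /(_ 0 (in_sort _ j1A) (in_sort _ jA))/eqP; rewrite subr1_neq.
move=> /(_ (sort_sorted tot _) (in_sort _ j1A) (in_sort _ jA)).
by rewrite /le_key leqNgt key_lt.
Qed.

Lemma d_eltP A : A \proper [set: I] ->
  exists2 u, @d_elt k.+1 A = Some u & @cyc_decreasing k.+1 A u.
Proof.
move=> /ex_cyc_decreasing[u uA]; rewrite /d_elt; case: pickP => [t tA|no].
  by exists (val t).
have su : size u == #|A| by case/andP: uA => /perm_size ->; rewrite -cardE.
by have := no (Tuple su); rewrite uA.
Qed.

(** A letter [c] makes entry [c] positive. Only a later letter [c + 1] could spoil this, but a
    cyclically decreasing word has [c + 1] before [c]. *)
Lemma act_cyc_decreasing_supp A u h g : @cyc_decreasing k.+1 A u ->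
  code_act (Some h) u = Some g -> A \subset supp g.
Proof.
move=> /cyc_decreasingP[uu uA ui] hg; apply/subsetP=> c; rewrite -uA inE.
have {}ui j : j \in u -> j - 1 \in u -> (index j u < index (j - 1)%R u)%N.
  by rewrite !uA; exact: ui.
elim/last_ind: u g uu ui hg c {uA} => [//|u r IH] g; rewrite rcons_uniq => /andP[ru uu] ui.
rewrite act_rcons; case E: (code_act (Some h) u) => [f|] //= B c.
have [_ gr _ gc] := bump_atP B.
rewrite mem_rcons inE; have [->|cr] := eqVneq c r; first by rewrite gr.
move=> /= cu; rewrite gc //; last first.
  apply/eqP=> cr1; have := ui r; rewrite !mem_rcons !inE eqxx -cr1 cu orbT => /(_ isT isT).
  by rewrite -!cats1 !index_cat (negPf ru) cu /= eqxx addn0 ltnNge ltnW // index_mem.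
apply: (IH f) => // j ju j1u; have := ui j; rewrite !mem_rcons !inE ju j1u !orbT.
by rewrite -!cats1 !index_cat ju j1u; apply.
Qed.

Definition shift_code h : code := [ffun c => (h (c + 1)%R).-1].

Lemma act_shift_code h u : @cyc_decreasing k.+1 (supp h) u ->
  code_act (Some (shift_code h)) u = Some h.
Proof.
move=> /cyc_decreasingP[uu uA ui].
(* The code reached after the prefix p of u: each maximal run of supp h is
   processed downwards, and the zero found above its top sits just below the part
   already processed. *)
pose mid (p : seq I) : code := [ffun c => if c \in p then h c else
  if c + 1 \in p then 0%N else (h (c + 1)%R).-1].
have suf p q : u = p ++ q -> code_act (Some (shift_code h)) p = Some (mid p).
  elim/last_ind: p q => [|p r IH] q; first by move=> _; congr Some; apply/ffunP=> c; rewrite !ffunE.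
  rewrite cat_rcons => def_u; rewrite act_rcons (IH _ def_u) /=.
  have rA : r \in supp h by rewrite -uA def_u mem_cat inE eqxx orbT.
  have rp : r \notin p by move: uu; rewrite def_u cat_uniq /= negb_or => /and3P[_ /andP[]].
  have r1p : r - 1 \notin p.
    apply/negP=> r1p; have := ui r rA; rewrite -uA def_u mem_cat r1p => /(_ isT).
    rewrite !index_cat (negPf rp) r1p /= eqxx addn0 ltnNge ltnW //.
    by rewrite index_mem.
  (* Either [r + 1] was processed and left its zero at [r], or it is outside the support. With a
     zero at [r] the move is allowed whatever stands at [r - 1]. *)
  have midr : mid p r = 0%N.
    rewrite ffunE (negPf rp); case: ifP => // rp1.
    have [r1A|] := boolP (r + 1 \in supp h); last by rewrite inE lt0n negbK => /eqP->.
    have := ui _ r1A; rewrite addrK => /(_ rA); rewrite def_u !index_cat rp1 (negPf rp) /= eqxx.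
    by rewrite addn0 ltnNge leq_addr.
  apply: bump_atE; rewrite ?midr // ?ffunE ?mem_rcons ?inE ?eqxx ?subrK //=.
  - by rewrite (negPf rp) (negPf r1p) prednK //; move: rA; rewrite inE.
  - by rewrite subr1_neq (negPf r1p) eqxx.
  - move=> c cr cr1; rewrite !ffunE !mem_rcons !inE (negPf cr) /=.
    by have -> : (c + 1 == r) = false by rewrite -subr_eq0 -addrA -opprB subr_eq0 (negPf cr1).
rewrite (suf u [::]) ?cats0 //; congr Some; apply/ffunP=> c; rewrite ffunE !uA !inE.
by case: (h c) (h (c+1)%R) => [|?] [|?].
Qed.

(** Decompositions transported to codes: the product acts on the zero code, that of the identity.
    The head of the list is the factor that acts last. *)
Definition decomposes (L : seq {set I}) h : Prop :=
  {in L, forall B, B != set0 /\ B \proper [set: I]} /\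
  nil_act (Some zero_code) (\big[@nil_mul k.+1/nil_one k.+1]_(B <- rev L) d_elt B) = Some h.

Lemma nil_act_big o (s : seq {set I}) :
  nil_act o (\big[@nil_mul k.+1/nil_one k.+1]_(B <- s) d_elt B) =
  foldl (fun o B => nil_act o (d_elt B)) o s.
Proof.
by elim: s o => [|B s IH] o; rewrite ?big_nil ?big_cons ?nil_act_mul //= IH.
Qed.

Lemma decomposes_nil h : decomposes [::] h <-> h = zero_code.
Proof. by rewrite /decomposes big_nil; split=> [[_ [<-]]|->]. Qed.

Lemma decomposes_cons B L h : decomposes (B :: L) h <->
  [/\ B != set0, B \proper [set: I] &
      exists2 g, decomposes L g & nil_act (Some g) (d_elt B) = Some h].
Proof.
rewrite /decomposes !nil_act_big rev_cons foldl_rcons; split.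
  case=> BL; case E: foldl => [g|]; last by rewrite nil_act_none.
  move=> gh; have [B0 BT] := BL _ (mem_head _ _); split=> //; exists g => //.
  by split=> // C CL; apply: BL; rewrite inE CL orbT.
case=> B0 BT [g [BL ->] gh]; split=> // C; rewrite inE => /predU1P[->//|]; exact: BL.
Qed.

Lemma decomposes_cons_supp B L h : decomposes (B :: L) h -> B \subset supp h.
Proof.
move=> /decomposes_cons[_ BT [g _]]; have [u -> uB] /= := d_eltP BT.
exact: act_cyc_decreasing_supp uB.
Qed.

(** As moves are injective, [shift_code h] is the only code that the word of [supp h] carries to
    [h]. *)
Lemma decomposes_supp L h : supp h != set0 -> supp h \proper [set: I] ->
  decomposes (supp h :: L) h <-> decomposes L (shift_code h).
Proof.
move=> h0 hT; have [u uE uh] := d_eltP hT; have sh := act_shift_code uh.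
rewrite decomposes_cons; split=> [[_ _ [g Lg]]|Lh].
  by rewrite uE /= => gh; rewrite (act_inj sh gh).
by split=> //; exists (shift_code h) => //; rewrite uE.
Qed.

Lemma supp0 h : (supp h == set0) = (h == zero_code).
Proof.
apply/eqP/eqP => [h0|->]; last by apply/setP=> c; rewrite !inE ffunE.
by apply/ffunP=> c; have := in_set0 c; rewrite -h0 inE ffunE lt0n => /negbFE/eqP.
Qed.

Lemma supp_proper h : (supp h \proper [set: I]) = [exists c, h c == 0%N].
Proof.
apply/properP/existsP => [[_ [c _]]|[c hc]]; first by rewrite inE lt0n negbK; exists c.
by split; [exact: subsetT | exists c; rewrite // inE lt0n negbK].
Qed.

(** Greedy choice: split off the whole support and recurse on the shifted code, whose sum is
    smaller; a zero entry keeps each support proper. In a competing [L] the first set lies in the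
    support and is at least as large, hence equal to it, and the comparison passes to the tails. *)
Lemma ex_code_decomposition h : [exists c, h c == 0%N] ->
  exists2 L0, decomposes L0 h &
  forall L, decomposes L h -> (@card_seq k.+1 L0 <= @card_seq k.+1 L)%O ->
  forall i c, (c - i%:R \in nth set0 L i) = (i < h c)%N.
Proof.
have [n] := ubnP (\sum_c h c)%N; elim: n h => // n IH h hn hT.
have [h0|h0] := eqVneq (supp h) set0.
  exists [::]; first by apply/decomposes_nil/eqP; rewrite -supp0 h0.
  case=> [|B L] Lh _ i c; last first.
    have := decomposes_cons_supp Lh; rewrite h0 subset0.
    by case/decomposes_cons: Lh => /negPf->.
  by rewrite nth_nil inE; move/eqP: h0; rewrite supp0 => /eqP->; rewrite ffunE.
have hpr : supp h \proper [set: I] by rewrite supp_proper.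
have [||L0 L0h L0P] := IH (shift_code h).
- apply: leq_trans (_ : \sum_c h c <= n)%N => //.
  have [c] := set0Pn _ h0; rewrite inE => hc.
  rewrite [X in (_ < X)%N](reindex_inj (addIr 1)) /=.
  rewrite (bigD1 (c - 1)) //= [X in (_ < X)%N](bigD1 (c - 1)) //= ffunE subrK.
  rewrite -addSn (prednK hc) leq_add2l leq_sum // => j _.
  by rewrite ffunE leq_pred.
- case/existsP: hT => c /eqP hc; apply/existsP; exists (c - 1).
  by rewrite ffunE subrK hc.
exists (supp h :: L0); first exact/decomposes_supp.
case=> [|B L] Lh //; rewrite /card_seq /= lexi_cons.
have Bh := decomposes_cons_supp Lh.
have cBh := subset_leq_card Bh.
move=> /andP[cB /implyP cL]; have {cB}cB : #|B| = #|supp h|.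
  by apply/eqP; rewrite eqn_leq cBh.
have defB : B = supp h by apply/eqP; rewrite eqEcard Bh cB leqnn.
rewrite {}defB {B Bh cBh} in Lh cB cL *.
have {}cL : (@card_seq k.+1 L0 <= @card_seq k.+1 L)%O by apply: cL.
have {}L0P := L0P L (proj1 (decomposes_supp _ h0 hpr) Lh) cL.
case=> [|i] c /=; first by rewrite subr0 inE.
(* Without its bottom row, column [c] becomes column [c - 1] of the shifted code, one box
   shorter. *)
have := L0P i (c - 1); rewrite -addrA -opprD nat1r ffunE subrK => ->.
by case: (h c).
Qed.

End CyclicallyDecreasing.

(** * Codes of affine permutations *)

Section LehmerCode.
Variable k : nat.
Local Notation I := 'Z_k.+2.
Local Notation n := (k.+2).
Local Notation code := {ffun I -> nat}.
Local Notation zero_code := (@zero_code k).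
Implicit Types (h g : code) (r c : I) (u v : seq I) (w f : int -> int) (i j a b : int).

(* The ceiling of a / n for a >= 0, and 0 for a < 0: the number of q >= 0 with
   q * n < a. *)
Definition pceil a : nat := if a is Posz m then (m + k.+1) %/ n else 0%N.

Lemma pceil_le0 a : a <= 0 -> pceil a = 0%N.
Proof. by case: a => [[|m]|m] //= _; rewrite add0n divn_small. Qed.

Lemma pceil_gt0 a : 0 < a -> pceil a = (pceil (a - n%:Z)).+1.
Proof.
case: a => // m m0; have [le_nm|lt_mn] := leqP n m.
  rewrite subzn //= (_ : m + k.+1 = (m - n + k.+1) + n)%N; last lia.
  by rewrite divnDr ?dvdnn // divnn /= addn1.
rewrite (@pceil_le0 (_ - _)) /=; last lia.
have -> : (m + k.+1 = (m.-1) + n)%N by lia.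
by rewrite divnDr ?dvdnn // divnn /= divn_small ?add0n //; lia.
Qed.

Lemma pceil_mono a b : a <= b -> (pceil a <= pceil b)%N.
Proof.
case: a b => [m|m] [p|p] //= le_mp; by rewrite leq_div2r // leq_add2r; lia.
Qed.

(** A predicate on bare functions, so that word products qualify without being packed into the
    record. *)
Definition affine w : Prop :=
  [/\ injective w, forall j, w (j + n%:Z) = w j + n%:Z &
      \sum_(1 <= m < n.+1) w m%:Z = \sum_(1 <= m < n.+1) m%:Z].

(* #{i <= j : w i > w (j + 1)}: the i congruent to j - t are the j - t - q * n,
   where w takes the value w (j - t) - q * n. *)
Definition inv_count w j : nat :=
  (\sum_(t < k.+1) pceil (w (j - t%:Z) - w (j + 1))%R)%N.

Definition perm_code w : code := [ffun c : I => inv_count w (c : nat)%:Z].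

Lemma perm_code_ext w w' : w =1 w' -> perm_code w = perm_code w'.
Proof.
move=> ww'; apply/ffunP=> c; rewrite !ffunE; apply: eq_bigr => t _.
by rewrite !ww'.
Qed.

Lemma class_nat (m : nat) : (m%:Z)%:~R = inZp m :> I.
Proof. by apply/val_inj; rewrite /= -[(m%:Z)%:~R]/(m%:R) Zp_nat. Qed.

Lemma class_val c : ((c : nat)%:Z)%:~R = c.
Proof. by rewrite class_nat valZpK. Qed.

Lemma class_eq0 j : (j%:~R == 0 :> I) -> exists q : int, j = q * n%:Z.
Proof.
have dvd (m : nat) : (m%:R == 0 :> I) -> exists q : nat, m = (q * n)%N.
  by rewrite Zp_nat => /eqP/(congr1 val)/= /eqP /dvdnP.
case: j => m; first by move=> /dvd[q ->]; exists q%:Z; rewrite PoszM.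
rewrite NegzE mulrNz oppr_eq0 => /dvd[q ->]; exists (- q%:Z).
by rewrite mulNr PoszM.
Qed.

Lemma class_eq i j : (i%:~R == j%:~R :> I) -> exists q : int, i = j + q * n%:Z.
Proof.
rewrite -subr_eq0 -intrB => /class_eq0[q ij]; exists q.
by rewrite -ij addrC subrK.
Qed.

Lemma class_neq i j : (0 < `|(i - j)%R|%N < n)%N -> i%:~R != j%:~R :> I.
Proof.
apply: contraL => /class_eq[q ->]; rewrite addrC addKr abszM /=.
by case: `|q|%N => [|p] => //; rewrite mulSn; lia.
Qed.

Lemma shift_mul w : (forall j, w (j + n%:Z) = w j + n%:Z) ->
  forall (q : int) j, w (j + q * n%:Z) = w j + q * n%:Z.
Proof.
move=> sh; have shN (q : nat) j : w (j + q%:Z * n%:Z) = w j + q%:Z * n%:Z.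
  elim: q => [|q IH]; first by rewrite mul0r !addr0.
  by rewrite -addn1 PoszD mulrDl mul1r !addrA sh IH.
case=> q j; first exact: shN.
rewrite NegzE mulNr; apply: (addIr (q.+1%:Z * n%:Z)).
by rewrite -shN subrK subrK.
Qed.

Lemma inv_count_shift w j q : (forall j, w (j + n%:Z) = w j + n%:Z) ->
  inv_count w (j + q * n%:Z) = inv_count w j.
Proof.
move=> sh; apply: eq_bigr => t _.
rewrite (addrAC j _ 1) (addrAC j _ (- _)) !(shift_mul sh); congr pceil; ring.
Qed.

(** [perm_code] is computed at the representative in [[0, n)]; periodicity allows any other
    integer. *)
Lemma perm_codeE w j : (forall j, w (j + n%:Z) = w j + n%:Z) ->
  perm_code w j%:~R = inv_count w j.
Proof.
move=> sh; rewrite ffunE; have /eqP/class_eq[q def_j] := esym (class_val j%:~R).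
by rewrite [in RHS]def_j inv_count_shift.
Qed.

Local Notation srefl := (@simple_refl k.+1).

Lemma srefl_l r j : j%:~R = r -> srefl r j = j + 1.
Proof. by move=> jr; rewrite /simple_refl jr eqxx. Qed.

Lemma srefl_r r j : j%:~R = r -> srefl r (j + 1) = j.
Proof.
move=> jr; rewrite /simple_refl intrD jr eqxx -[r + _ == r]subr_eq0 addrAC subrr add0r.
by rewrite oner_eq0 addrK.
Qed.

Lemma srefl_id r j : j%:~R != r -> j%:~R != r + 1 -> srefl r j = j.
Proof. by rewrite /simple_refl => /negPf-> /negPf->. Qed.

Lemma sreflK r : involutive (srefl r).
Proof.
move=> j; have [jr|jr] := eqVneq j%:~R r; first by rewrite (srefl_l jr) (srefl_r jr).
have [jr1|jr1] := eqVneq j%:~R (r + 1); last by rewrite !(srefl_id jr jr1).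
have jr' : (j - 1)%:~R = r by rewrite intrB jr1 addrK.
have {1}-> : j = j - 1 + 1 by rewrite subrK.
by rewrite (srefl_r jr') (srefl_l jr') subrK.
Qed.

Lemma class_period : (n%:Z)%:~R = 0 :> I.
Proof.
by rewrite class_nat; apply/val_inj; rewrite /= -[X in (_ %% X)%N]/n modnn.
Qed.

Lemma srefl_shift r j : srefl r (j + n%:Z) = srefl r j + n%:Z.
Proof.
have e : (j + n%:Z)%:~R = j%:~R :> I.
  by rewrite intrD class_period addr0.
by rewrite /simple_refl e; case: ifP => _; [|case: ifP => _]; rewrite // addrAC.
Qed.

Lemma sum_periodic (f : int -> int) : (forall j, f (j + n%:Z) = f j) ->
  \sum_(1 <= m < n.+1) f m%:Z = \sum_(c : I) f (c : nat)%:Z.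
Proof.
move=> per; rewrite big_nat_recr //= -(add0r n%:Z) per.
rewrite -[RHS](big_mkord xpredT (fun m : nat => f m%:Z)) [RHS]big_ltn //.
exact: addrC.
Qed.

Lemma affine_refl w r : affine w -> affine (w \o srefl r).
Proof.
case=> inj sh sm; split.
- exact: inj_comp inj (inv_inj (sreflK r)).
- by move=> j /=; rewrite srefl_shift sh.
rewrite -sm; apply/eqP; rewrite -subr_eq0 -sumrB.
(* The two sums differ by the sum of this periodic displacement. It is supported on the classes of
   [r] and [r + 1], where its values are opposite. *)
pose f j := w (srefl r j) - w j.
have per j : f (j + n%:Z) = f j by rewrite /f srefl_shift !sh; ring.
rewrite (sum_periodic per) (bigD1 r) // (bigD1 (r + 1)) /=; last first.
  by rewrite -subr_eq0 addrAC subrr add0r oner_eq0.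
rewrite big1 => [|c /andP[cr cr1]]; last by rewrite /f srefl_id ?subrr ?class_val.
(* The representative of [r + 1] wraps to 0 when [r] is the last residue. *)
have -> : f (nat_of_ord (r + 1))%:Z = f (r%:Z + 1).
  have /eqP/class_eq[q ->] : (nat_of_ord (r + 1))%:Z%:~R = (r%:Z + 1)%:~R :> I.
    by rewrite intrD !class_val.
  by rewrite /f (shift_mul (srefl_shift r)) !(shift_mul sh); ring.
rewrite /f (srefl_l (class_val r)) (srefl_r (class_val r)).
by apply/eqP; ring.
Qed.

Lemma word_prod_rcons u r : word_prod (rcons u r) =1 word_prod u \o srefl r.
Proof. by elim: u => //= s u IHu j; rewrite /= IHu. Qed.

Lemma affine_word u : affine (word_prod u).
Proof.
elim/last_ind: u => [|u r IH]; first by split=> // i j.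
have wu := word_prod_rcons u r.
have [inj sh sm] := affine_refl r IH; split.
- exact: eq_inj inj (fsym wu).
- by move=> j; rewrite !wu sh.
- by rewrite -sm; apply: eq_bigr => m _; rewrite wu.
Qed.

(** At [i - 1] and [i] the count splits into a sum [S] over the [k] other classes and one term
    comparing [w i] with [w (i + 1)]. The exchange swaps the arguments of [S] and moves the
    comparing term from [i - 1] to [i], where it is one larger. At other entries it permutes
    summands. *)
Lemma perm_code_ascent w r : affine w -> w r%:Z < w (r%:Z + 1) ->
  bump_at (perm_code w) r = Some (perm_code (w \o srefl r)).
Proof.
move=> aw; set i := r%:Z => asc; have [_ sh _] := aw.
have [_ sh' _] := affine_refl r aw; set w' := w \o srefl r.
have ir : i%:~R = r by exact: class_val.
have i1r : (i - 1)%:~R = r - 1 by rewrite intrB ir.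
pose S a : nat := (\sum_(t < k) pceil (w (i - 1 - t%:Z) - a)%R)%N.
have Hi (z : int -> int) : (forall j, z (j + n%:Z) = z j + n%:Z) ->
  (forall t : 'I_k, z (i - 1 - t%:Z) = w (i - 1 - t%:Z)) ->
  inv_count z i = (pceil (z i - z (i + 1))%R + S (z (i + 1)%R))%N /\
  inv_count z (i - 1) = (S (z i) + pceil (z (i + 1) - z i - n%:Z)%R)%N.
  move=> shz zw; rewrite /inv_count big_ord_recl subr0; split.
    congr addn; apply: eq_bigr => t _; rewrite -zw; congr (pceil (z _ - _)).
    by rewrite lift0 -add1n PoszD opprD addrA.
  rewrite subrK big_ord_recr /=; congr addn; first by apply: eq_bigr => t _; rewrite zw.
  (* The last class counted at [i - 1] is that of [i + 1], one period lower; hence the [- n]. *)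
  have -> : i - 1 - k%:Z = (i + 1) + (-1) * n%:Z by lia.
  by rewrite (shift_mul shz); congr pceil; ring.
have ww' (t : 'I_k) : w' (i - 1 - t%:Z) = w (i - 1 - t%:Z).
  rewrite /w' /= srefl_id // -ir -?(intrD _ _ 1); apply: class_neq; move: (ltn_ord t); lia.
have [w1 w2] := Hi _ sh (fun=> erefl); have [w1' w2'] := Hi w' sh' ww'.
have w'i : w' i = w (i + 1) by rewrite /w' /= srefl_l.
have w'i1 : w' (i + 1) = w i by rewrite /w' /= srefl_r.
rewrite w'i w'i1 in w1' w2'.
rewrite [pceil (w i - _)]pceil_le0 ?add0n in w1; last by lia.
rewrite [pceil (w i - _ - _)]pceil_le0 ?addn0 in w2'; last by lia.
rewrite pceil_gt0 in w1'; last by lia.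
apply: bump_atE; rewrite -?i1r -?ir ?perm_codeE //.
- rewrite w1 w2; apply: leq_trans (leq_addr _ _).
  by apply: leq_sum => t _; apply: pceil_mono; lia.
- by rewrite w1' w2 addSn addnC.
- by rewrite w1 w2'.
move=> c; rewrite ir i1r => cr cr1; rewrite !ffunE; set j := (c : nat)%:Z.
have jc : j%:~R = c by exact: class_val.
(* [d] is the offset from [j] down to the class of [r + 1]. Since [c] is neither [r] nor [r - 1],
   [d] is neither [k + 1] nor [k], so [d] and [d + 1] both index summands, and [w'] swaps these
   two. *)
pose d := c - (r + 1); have dE : (j - d%:Z)%:~R = r + 1.
  by rewrite intrB jc class_val /d subKr.
have d_lt : (d < k)%N.
  have : (d < n)%N by exact: ltn_ord d.
  rewrite ltnS leq_eqVlt => /orP[/eqP dk|].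
    case/eqP: cr; move: dE; rewrite dk.
    have -> : j - k.+1%:Z = j + 1 - n%:Z by lia.
    by rewrite intrB class_period subr0 intrD jc => /addIr.
  rewrite ltnS leq_eqVlt => /orP[/eqP dk|//].
  case/eqP: cr1; move: dE; rewrite dk.
  have -> : j - k%:Z = j + 1 + 1 - n%:Z by lia.
  by rewrite intrB class_period subr0 !intrD jc => /addIr <-; rewrite addrK.
pose p : 'I_k.+1 := inord d; pose q : 'I_k.+1 := inord d.+1.
have pE : p = d :> nat by rewrite inordK // ltnW.
have qE : q = d.+1 :> nat by rewrite inordK.
rewrite /inv_count [RHS](reindex_inj (@perm_inj _ (tperm p q))).
have -> : w' (j + 1) = w (j + 1).
  rewrite /w' /= srefl_id // intrD jc ?(inj_eq (addIr _)) //.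
  by apply: contraNneq cr1 => <-; rewrite addrK.
apply: eq_bigr => t _; congr (pceil (_ - _)); rewrite /w' /=.
have dl : (j - d.+1%:Z)%:~R = r.
  have -> : j - d.+1%:Z = j - d%:Z - 1 by lia.
  by rewrite intrB dE addrK.
case: tpermP => [->|->|tp tq].
- rewrite pE qE -(srefl_r dl); congr (w (srefl _ _)); lia.
- rewrite pE qE (srefl_l dl); congr w; lia.
rewrite srefl_id //.
- have {}tq : (t : nat) <> d.+1 by move=> e; apply/tq/val_inj; rewrite /= qE.
  rewrite -dl; apply: class_neq; move: tq d_lt (ltn_ord t).
  by move: (nat_of_ord t) (nat_of_ord d) => a b; lia.
- have {}tp : (t : nat) <> d by move=> e; apply/tp/val_inj; rewrite /= pE.
  rewrite -dE; apply: class_neq; move: tp d_lt (ltn_ord t).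
  by move: (nat_of_ord t) (nat_of_ord d) => a b; lia.
Qed.

End LehmerCode.

(** * Reduced words and right descents read from codes *)

Section ReducedWords.
Variable k : nat.
Local Notation I := 'Z_k.+2.
Local Notation n := (k.+2).
Local Notation code := {ffun I -> nat}.
Local Notation zero_code := (@zero_code k).
Local Notation affine := (@affine k).
Local Notation perm_code := (@perm_code k).
Local Notation srefl := (@simple_refl k.+1).
Implicit Types (h g : code) (r c : I) (u v : seq I) (w f : int -> int) (i j a b : int).

Lemma perm_code_step w r : affine w ->
  bump_at (perm_code w) r = Some (perm_code (w \o srefl r)) \/
  bump_at (perm_code (w \o srefl r)) r = Some (perm_code w).
Proof.
move=> aw; have [inj _ _] := aw.
case: (ltgtP (w r%:Z) (w (r%:Z + 1))) => [lt_w|gt_w|/inj]; last by lia.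
- by left; exact: perm_code_ascent.
- right; rewrite perm_code_ascent; first 1 last.
  + exact: affine_refl.
  + by rewrite /= (srefl_l (class_val r)) (srefl_r (class_val r)).
  by congr Some; apply: perm_code_ext => j /=; rewrite sreflK.
Qed.

(** The term [t = 0] of each count shows that [w] increases at every step. Over one period [n] steps
    gain exactly [n], so each gains one, and the normalised sum rules out a translation. *)
Lemma perm_code_eq0 w : affine w -> perm_code w = zero_code -> w =1 id.
Proof.
case=> inj sh sm w0.
have asc j : w j < w (j + 1).
  have : inv_count k w j = 0%N by rewrite -perm_codeE // w0 ffunE.
  rewrite /inv_count big_ord_recl subr0 => /eqP; rewrite addn_eq0 => /andP[p0 _].
  rewrite lt_neqAle; apply/andP; split; first by apply/eqP => /inj; lia.
  by rewrite leNgt -subr_gt0; apply: contraL p0 => /pceil_gt0 ->.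
have asc_add j (m : nat) : w j + m%:Z <= w (j + m%:Z).
  elim: m => [|m IH]; first by rewrite !addr0.
  by rewrite -addn1 PoszD !addrA lezD1; exact: le_lt_trans IH (asc _).
have step j : w (j + 1) = w j + 1.
  have := asc_add (j + 1) k.+1; have -> : j + 1 + k.+1%:Z = j + n%:Z by lia.
  rewrite sh; have := asc j; lia.
have wn (m : nat) : w m%:Z = w 0 + m%:Z.
  elim: m => [|m IH]; first by rewrite addr0.
  by rewrite -addn1 PoszD step IH addrA.
have w00 : w 0 = 0.
  move: sm; under eq_bigr => m _ do rewrite wn.
  rewrite big_split /= -[RHS]add0r => /addIr; rewrite sumr_const_nat subn1 /=.
  by move/eqP; rewrite mulrn_eq0 => /eqP.
(* [wn] covers nonnegative integers only; adding [|j|] periods to [j] reaches them. *)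
move=> j; have := wn `|(j + `|j| * n%:Z)%R|%N; rewrite w00 add0r gez0_abs; last by nia.
by rewrite (shift_mul sh) => /addIr.
Qed.

(** Take the position of the greatest value in a window of [n] consecutive integers: no value
    further left exceeds it, so the entry just before that position is zero. *)
Lemma perm_code_zero w : affine w -> [exists c, perm_code w c == 0%N].
Proof.
case=> _ sh _; pose F (t : 'I_n) := w (- t%:Z).
case: (@arg_maxP _ _ _ ord0 xpredT F isT) => t _ tmax.
apply/existsP; exists (- t%:Z - 1)%:~R; rewrite perm_codeE // /inv_count subrK.
rewrite big1 // => s _; apply: pceil_le0; rewrite subr_le0.
have [lt_n|le_n] := ltnP (t + 1 + s) n.
  have := tmax (Ordinal lt_n) isT; rewrite /F /=.
  by have -> : - (t + 1 + s)%:Z = - t%:Z - 1 - s%:Z by lia.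
have lt_n : (t + 1 + s - n < n)%N by move: (ltn_ord t) (ltn_ord s); lia.
have := tmax (Ordinal lt_n) isT; rewrite /F /=.
have -> : - t%:Z - 1 - s%:Z = - (t + 1 + s - n)%:Z + (-1) * n%:Z by lia.
rewrite (shift_mul sh); lia.
Qed.

(** Undo the last letter [r]: the final code rises at [r], so by injectivity the previous code is
    that of [w \o srefl r]. *)
Lemma act_perm_code w u : affine w ->
  code_act (Some zero_code) u = Some (perm_code w) -> word_prod u =1 w.
Proof.
elim/last_ind: u w => [|u r IH] w aw.
  by move=> [w0] j; rewrite (perm_code_eq0 aw).
rewrite act_rcons; case E: (code_act _ u) => [g|] //= gw j.
rewrite word_prod_rcons /= (IH (w \o srefl r)) /= ?sreflK //; first exact: affine_refl.
rewrite E; case: (perm_code_step r aw) => [ww|/(bump_at_inj gw) -> //].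
by have := bump_at_lt gw; have [le_w _ _ _] := bump_atP ww; rewrite ltnNge le_w.
Qed.

(** Each letter changes the sum by one, up or down. Equality forces every letter to go up, and then
    the action never vanishes. *)
Lemma sum_perm_code_word u :
  (\sum_c perm_code (word_prod u) c <= size u)%N /\
  (\sum_c perm_code (word_prod u) c = size u ->
   code_act (Some zero_code) u = Some (perm_code (word_prod u)))%N.
Proof.
elim/last_ind: u => [|u r [IHle IHeq]].
  have id0 : perm_code id = zero_code.
    apply/ffunP=> c; rewrite !ffunE /inv_count big1 // => t _.
    by apply: pceil_le0; lia.
  by rewrite /= -/(@id int) id0 big1 // => c _; rewrite ffunE.
rewrite size_rcons act_rcons (perm_code_ext _ (word_prod_rcons u r)).
case: (perm_code_step r (affine_word u)) => [up|down].
  rewrite (sum_bump_at up) ltnS; split=> // -[/IHeq ->] /=; exact: up.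
have := sum_bump_at down; lia.
Qed.

Lemma ex_act_code h : [exists c, h c == 0%N] ->
  exists u, code_act (Some zero_code) u = Some h.
Proof.
case/ex_code_decomposition=> L [_]; case: (\big[_/_]_(_ <- _) _) => // u Lh _.
by exists u.
Qed.

Lemma affine_aperm (x : affine_perm k.+1) : affine x.
Proof.
by split; [exact: bij_inj (aperm_bij x) | exact: aperm_shift | exact: aperm_sum].
Qed.

(** The sum of the code bounds the size of every word of [x] from below, and [ex_act_code] supplies
    a word attaining the bound. *)
Lemma reduced_wordP (x : affine_perm k.+1) u :
  reduced_word x u <-> code_act (Some zero_code) u = Some (perm_code x).
Proof.
have ax := affine_aperm x; split=> [[ux umin]|ux].
  have [le_u eq_u] := sum_perm_code_word u; rewrite (perm_code_ext _ ux) in le_u eq_u.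
  apply: eq_u; apply/eqP; rewrite eqn_leq le_u.
  have [v vx] := ex_act_code (perm_code_zero ax).
  by rewrite (sum_act vx) umin //; exact: act_perm_code.
split; first exact: act_perm_code.
move=> v vx; rewrite -(sum_act ux) -(perm_code_ext _ vx).
by have [] := sum_perm_code_word v.
Qed.

(** If the product with [r] is zero, then so is its action on the zero code, so the move at [r] is
    blocked. Conversely a rise at [r] gives a reduced word ending in [r], and the square of this
    generator vanishes. *)
Lemma perm_right_descentP (x : affine_perm k.+1) r :
  perm_right_descent x r <-> (perm_code x (r - 1)%R < perm_code x r)%N.
Proof.
have ax := affine_aperm x; split.
  case=> m [u /reduced_wordP ux mu] /nilcox_nil_act/(_ (Some zero_code)).
  rewrite nil_act_mul (nilcox_nil_act mu) /= ux /= /bump_at.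
  by case: leqP.
move=> x_r; case: (perm_code_step r ax) => [/bump_atP[]|down]; first by rewrite leqNgt x_r.
have [v vy] := ex_act_code (perm_code_zero (affine_refl r ax)).
exists (Some (rcons v r)).
  exists (rcons v r); last exact: nilcox_refl.
  by apply/reduced_wordP; rewrite act_rcons vy.
rewrite /right_descent; have -> : nil_mul (Some (rcons v r)) (nil_gen r) =
  nil_mul (Some v) (nil_mul (nil_gen r) (nil_gen r)) by rewrite /= cat_rcons.
rewrite -[nil_zero _]/(nil_mul (Some v) (nil_zero k.+1)).
by apply: nilcox_mul; [exact: nilcox_refl | exact: nilcox_square].
Qed.

Lemma d_elt_right_descent (B : {set I}) r : B \proper [set: I] ->
  right_descent (@d_elt k.+1 B) r <-> (r \in B) && (r - 1 \notin B).
Proof.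
case/d_eltP=> u -> uB; split.
  (* Test on the indicator code of [B], which the word of [B] reaches and where the moves blocked
     are easy to read. *)
  pose h : code := [ffun c => (c \in B : nat)].
  have hB : supp h = B by apply/setP=> c; rewrite inE ffunE lt0b.
  rewrite -hB in uB; have uh := act_shift_code uB.
  move=> /nilcox_nil_act/(_ (Some (shift_code h))); rewrite nil_act_mul /= uh /= /bump_at.
  by case: leqP => // + _; rewrite !ffunE; case: (r \in B); case: (r - 1 \in B).
case/andP=> rB r1B; have [_ uE ui] := cyc_decreasingP _ _ uB.
have ru : r \in u by rewrite uE.
have := uB; case/splitPr: ru => p q /cyc_decreasingP[uu {}uE {}ui].
(* Every letter after [r] commutes with it: [r - 1] is not in [B] and [r + 1] must precede [r]. So
   an appended [r] slides left to meet the first one. *)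
have rs : {in q, forall s, s \notin [:: r - 1; r; r + 1]}.
  move: uu; rewrite cat_uniq => /and3P[_ pq /= /andP[rq _]].
  have rp : r \notin p by apply: contra pq => rp; apply/hasP; exists r; rewrite ?mem_head.
  move=> s sq; have su : s \in p ++ r :: q by rewrite mem_cat inE sq !orbT.
  have sp : s \notin p.
    by apply: contra pq => sp; apply/hasP; exists s; rewrite // inE sq orbT.
  rewrite !inE !negb_or; apply/and3P; split.
  - by apply: contraNneq r1B => <-; rewrite -uE.
  - by apply: contraNneq rq => <-.
  apply/eqP=> sr; have := ui s; rewrite -uE su sr addrK => /(_ isT rB).
  by rewrite -sr !index_cat (negPf sp) (negPf rp) /= eqxx addn0 ltnNge leq_addr.
have qr : nilcox_eq (nil_mul (Some q) (nil_gen r)) (nil_mul (nil_gen r) (Some q)).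
  elim: q rs {uu uE ui uB} => [_|s q IH rs]; first exact: nilcox_refl.
  apply: (@nilcox_trans _ _ (nil_mul (nil_gen s) (nil_mul (nil_gen r) (Some q)))).
    apply: (@nilcox_mul _ (nil_gen s) _ (nil_mul (Some q) (nil_gen r))).
      exact: nilcox_refl.
    by apply: IH => s' s'q; apply: rs; rewrite inE s'q orbT.
  apply: (@nilcox_mul _ (nil_mul (nil_gen s) (nil_gen r)) (nil_mul (nil_gen r) (nil_gen s))
    (Some q) (Some q)); last exact: nilcox_refl.
  by apply/nilcox_sym/nilcox_comm/rs/mem_head.
rewrite /right_descent; have -> : nil_mul (Some (p ++ r :: q)) (nil_gen r) =
  nil_mul (Some (rcons p r)) (nil_mul (Some q) (nil_gen r)).
  by rewrite /= catA cat_rcons.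
apply: nilcox_trans (nilcox_mul (nilcox_refl _) qr) _.
have -> : nil_mul (Some (rcons p r)) (nil_mul (nil_gen r) (Some q)) =
  nil_mul (Some p) (nil_mul (nil_mul (nil_gen r) (nil_gen r)) (Some q)).
  by rewrite /= cat_rcons.
rewrite -[nil_zero _]/(nil_mul (Some p) (nil_mul (nil_zero k.+1) (Some q))).
apply: nilcox_mul; first exact: nilcox_refl.
by apply: nilcox_mul; [exact: nilcox_square | exact: nilcox_refl].
Qed.

End ReducedWords.

Theorem corollary36 (k : nat) (hk : (1 <= k)%N) (x : affine_perm k)
    (A : seq {set 'Z_k.+1}) (hA : maximal_decomposition x A) (r : 'Z_k.+1) :
  perm_right_descent x r <->
  exists b : box k,
    [/\ filling A b, box_row b = 1%N, box_res b = r &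
        exists b' : box k,
          [/\ filling A b', box_col b' = box_col b &
              right_descent (d_elt (row_set A (box_row b'))) (box_res b')]].
Proof.
case: k hk x A hA r => [//|k] _ x A [[Apr [u /reduced_wordP ux Au]] Amax] r.
rewrite perm_right_descentP; have ax := affine_aperm x.
have [L0 [L0pr L0x] L0P] := ex_code_decomposition (perm_code_zero ax).
have {L0pr L0x}L0dec : decomposition x L0.
  split=> //; move: L0x; case: (\big[_/_]_(_ <- _) _) => // v vx.
  by exists v; [apply/reduced_wordP | exact: nilcox_refl].
have Ah : decomposes A (perm_code k x).
  by split=> //; rewrite (nilcox_nil_act Au).
(* Maximality gives the comparison with the greedy [L0], so column [c] has height
   [perm_code k x c]. *)
have {L0P Amax L0dec}col := L0P A Ah (Amax _ L0dec).
(* In row [i + 1] the residue preceding that of column [c] sits in column [c - 1], which must not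
   reach this row. *)
have descP i c : (i < size A)%N ->
  right_descent (d_elt (nth set0 A i)) (c - i%:R) <->
  (perm_code k x (c - 1)%R <= i < perm_code k x c)%N.
  move=> iA; have [_ Ai] := Apr _ (mem_nth set0 iA).
  rewrite d_elt_right_descent // addrAC !col -leqNgt andbC; split=> [/andP[]|/andP[]] *; exact/andP.
split=> [lt_r|[[i0 c s] [/and3P[_ _ /= /eqP bc] /= i01 sr [[i' c' s'] [/and3P[/= iA _ /eqP bc'] /= cc' des]]]]].
  have rA i : (i < perm_code k x r)%N -> (i < size A)%N.
    by rewrite -col; case: ltnP => // le_A; rewrite nth_default ?inE.
  exists (Box 1 r r); split=> //.
    rewrite /filling /row_set /= rA ?(leq_ltn_trans _ lt_r) //.
    by rewrite addr0 eqxx -[r]subr0 (col 0%N) (leq_ltn_trans _ lt_r).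
  (* The witness lies in the lowest row that column [r - 1] does not reach. *)
  set i := perm_code k x (r - 1); exists (Box i.+1 r (r - i%:R)); split=> //.
    by rewrite /filling /row_set /= subrK eqxx andbT rA // col.
  by apply/descP; [exact: rA | rewrite leqnn].
case: i' iA bc' des => // i iA bc'; rewrite /row_set /=.
have -> : s' = r - i%:R by move: bc; rewrite i01 addr0 => bc; rewrite -sr -bc -cc' bc' addrK.
by move=> /descP-/(_ iA)/andP[]; exact: leq_ltn_trans.
Qed.
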